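(* Let $n\ge1$, let $\alpha=(\alpha_1,\dots,\alpha_n)\in\mathbb{R}^n$ with $\alpha\neq0$, let $J(t)=\cosh(\alpha\cdot t)-1$ for $t\in\mathbb{R}^n$, and let $g_{ij}(t)=\frac{\partial^2J}{\partial t_i\partial t_j}(t)$. Then at every $t\in\mathbb{R}^n$ the kernel of the symmetric bilinear form $g(t)$ is $$\mathcal{R}_\alpha=\{v\in\mathbb{R}^n:\alpha\cdot v=0\},$$ which has dimension $n-1$. The resulting (radical) distribution on $\mathbb{R}^n$ is integrable, and its leaves are the affine hyperplanes $\{t\in\mathbb{R}^n:\alpha\cdot t=\mathrm{const}\}$.
   Context: $\alpha\cdot t=\sum_{i=1}^n\alpha_it_i$ is the standard inner product. The kernel of a symmetric bilinear form $g$ is $\{v: g(v,w)=0\text{ for all }w\}$. The distribution assigns the subspace $\mathcal{R}_\alpha\subset T_t\mathbb{R}^n\cong\mathbb{R}^n$ to every point $t$; integrable means that through every point passes an immersed submanifold (leaf) whose tangent space at each of its points is the distribution. *)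

(* Defs.v *)
From HB Require Import structures.
From mathcomp Require Import all_boot all_order all_algebra.
From mathcomp Require Import all_classical reals topology normedtype sequences derive exp.

Set Implicit Arguments.
Unset Strict Implicit.
Unset Printing Implicit Defensive.

Import Order.TTheory GRing.Theory Num.Theory.
Import numFieldNormedType.Exports.

Local Open Scope classical_set_scope.
Local Open Scope ring_scope.

Definition cosh (R : realType) (x : R) : R := (expR x + expR (- x)) / 2.

Definition dot (R : realType) (n : nat) (u v : 'rV[R]_n) : R :=
  \sum_(i < n) u 0 i * v 0 i.

Definition hessian (R : realType) (n : nat) (f : 'rV[R]_n -> R)
    (t : 'rV[R]_n) : 'M[R]_n :=
  \matrix_(i, j) 'D_(delta_mx 0 i) ('D_(delta_mx 0 j) f) t.

Definition bilin (R : realType) (n : nat) (g : 'M[R]_n) (v w : 'rV[R]_n) : R :=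
  \sum_(i < n) \sum_(j < n) g i j * v 0 i * w 0 j.

Definition bilin_kernel (R : realType) (n : nat) (g : 'M[R]_n) :
    set 'rV[R]_n :=
  [set v | forall w, bilin g v w = 0].

Definition has_dimension (R : realType) (n : nat) (S : set 'rV[R]_n)
    (d : nat) : Prop :=
  exists V : {vspace 'rV[R]_n}, [set v | v \in V] = S /\ \dim V = d.

(* C^oo on the open set U: every iterated directional derivative of f (for
   vs = [::], f itself) is differentiable at every point of U. *)
Definition smooth_on (R : realType) (k n : nat) (U : set 'rV[R]_k)
    (f : 'rV[R]_k -> 'rV[R]_n) : Prop :=
  forall (vs : seq 'rV[R]_k) u, U u ->
    differentiable (foldr (fun v h => 'D_v h) f vs) u.

(* psi restricted to the open set U is a homeomorphism onto an open subset of M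
   (the inverse of a chart) through which iota is a smooth immersion. *)
Definition immersed_param (R : realType) (k n : nat) (M : topologicalType)
    (iota : M -> 'rV[R]_n) (U : set 'rV[R]_k) (psi : 'rV[R]_k -> M) : Prop :=
  [/\ open U,
      {in U &, injective psi},
      {within U, continuous psi},
      (forall W : set 'rV[R]_k, W `<=` U -> open W -> open (psi @` W))
    & smooth_on U (iota \o psi) /\
      forall u, U u -> injective ('d (iota \o psi) u)].

(* Immersed submanifolds of R^n, as injectively immersed manifolds.  No
   compatibility condition between parametrizations is needed: since iota \o psi
   is an immersion and psi a homeomorphism onto its open image, the changes of
   parametrization are automatically smooth. *)
Record immersed_submanifold (R : realType) (n : nat) := ImmersedSubmanifold {
  sm_dim : nat ;
  sm_space : topologicalType ;
  sm_incl : sm_space -> 'rV[R]_n ;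
  sm_hausdorff : hausdorff_space sm_space ;
  sm_second_countable : @second_countable sm_space ;
  sm_incl_inj : injective sm_incl ;
  sm_param : forall p : sm_space,
    exists (U : set 'rV[R]_sm_dim) (psi : 'rV[R]_sm_dim -> sm_space),
      immersed_param sm_incl U psi /\ (psi @` U) p
}.

Definition sm_points (R : realType) (n : nat)
    (M : immersed_submanifold R n) : set 'rV[R]_n :=
  range (@sm_incl R n M).

Definition tangent_space (R : realType) (n : nat)
    (M : immersed_submanifold R n) (p : sm_space M) : set 'rV[R]_n :=
  [set v | exists (U : set 'rV[R]_(sm_dim M))
                  (psi : 'rV[R]_(sm_dim M) -> sm_space M)
                  (u w : 'rV[R]_(sm_dim M)),
     [/\ immersed_param (@sm_incl R n M) U psi, U u, psi u = p
       & v = 'd (@sm_incl R n M \o psi) u w]].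

(* A distribution on R^n is given by the map t |-> D t, T_t R^n = R^n. *)
Definition integral_submanifold (R : realType) (n : nat)
    (D : 'rV[R]_n -> set 'rV[R]_n) (M : immersed_submanifold R n) : Prop :=
  forall p : sm_space M, tangent_space p = D (sm_incl p).

Definition integrable_distribution (R : realType) (n : nat)
    (D : 'rV[R]_n -> set 'rV[R]_n) : Prop :=
  forall t, exists M, integral_submanifold D M /\ sm_points M t.

(* Connectedness is for the intrinsic topology of the immersed submanifold, not
   for the topology induced by R^n. *)
Definition connected_integral (R : realType) (n : nat)
    (D : 'rV[R]_n -> set 'rV[R]_n) (M : immersed_submanifold R n) : Prop :=
  integral_submanifold D M /\ connected [set: sm_space M].

(* The leaves are the maximal nonempty connected integral submanifolds. *)
Definition leaf (R : realType) (n : nat) (D : 'rV[R]_n -> set 'rV[R]_n)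
    (L : set 'rV[R]_n) : Prop :=
  L !=set0 /\
  exists M, [/\ connected_integral D M, sm_points M = L
    & forall M', connected_integral D M' ->
        L `<=` sm_points M' -> sm_points M' = L].

(* Main.v *)
Require Import Defs.
From HB Require Import structures.
From mathcomp Require Import all_boot all_order all_algebra.
From mathcomp Require Import all_classical reals topology normedtype sequences derive exp realfun.
From mathcomp Require Import ring.

(** The Hessian of J at t is cosh(alpha.t) alpha^T alpha, and cosh > 0, so its
    kernel is the constant hyperplane orthogonal to alpha.  The hyperplane
    alpha.t = c is an integral submanifold, parametrized globally by an affine
    map.  On any integral submanifold the function alpha.t has zero
    differential in every parametrization, hence is locally constant, and
    constant when the submanifold is connected.  Every connected integral
    submanifold thus lies in one hyperplane, which makes the hyperplanes exactly
    the maximal ones. *)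

Set Implicit Arguments.
Unset Strict Implicit.
Unset Printing Implicit Defensive.

Import numFieldNormedType.Exports.
Import Order.TTheory GRing.Theory Num.Theory.
Local Open Scope classical_set_scope.
Local Open Scope ring_scope.

(** * Topological and calculus preliminaries *)

Lemma rV_second_countable (R : realType) (k : nat) :
  @second_countable 'rV[R]_k.
Proof.
pose box (p : 'rV[rat]_k * nat) : set 'rV[R]_k :=
  ball (map_mx ratr p.1 : 'rV[R]_k) p.2.+1%:R^-1.
exists (range box); first exact: (sub_countable (card_image_le _ _) (countableP _)).
split=> [_ [p _ <-]|x V /nbhs_ballP[e /= e0 xeV]]; first exact: ball_open.
have e20 : 0 < e / 2 by rewrite divr_gt0.
(* With radius below [e / 2], a ball that contains [x] stays inside the [e]-ball around [x], so a
   rational centre close to [x] suffices. *)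
have [N] := ltr_add_invr e20; rewrite add0r => Ne.
have N0 : 0 < N.+1%:R^-1 :> R by rewrite invr_gt0.
have qP (i : 'I_k) :
    exists q : rat, ratr q \in `]x 0 i - N.+1%:R^-1, x 0 i + N.+1%:R^-1[.
  by apply: rat_in_itvoo; rewrite ltrBlDr -addrA ltrDl addr_gt0.
have [q {}qP] := choice qP.
have qx : ball (map_mx ratr (\row_i q i) : 'rV[R]_k) N.+1%:R^-1 x.
  split=> // i j; rewrite !mxE ord1 /ball /= ltr_distl.
  by have := qP j; rewrite in_itv /= => /andP[h1 h2]; rewrite ltrBlDr h2 -ltrBlDr h1.
exists (box (\row_i q i, N)); first by split=> //; exists (\row_i q i, N).
move=> y qy; apply: xeV; rewrite /= [e]splitr.
by apply: ball_triangle; [apply/ball_sym/(le_ball (ltW Ne))/qx|apply/(le_ball (ltW Ne))].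
Qed.

(** The space is the union of the lines through 0, each a continuous image of the real line. *)
Lemma normedModType_connected (R : realType) (V : normedModType R) :
  connected [set: V].
Proof.
have -> : [set: V] = \bigcup_(v in [set: V]) range (fun s : R => s *: v).
  by apply/seteqP; split=> // v _; exists v => //; exists 1; rewrite ?scale1r.
apply: bigcup_connected => [|v _]; first by exists 0 => v _; exists 0; rewrite ?scale0r.
apply: connected_continuous_connected; first exact/connected_intervalP.
by apply: continuous_subspaceT; exact: scalel_continuous.
Qed.

(** Local constancy makes the preimage of every set open, so each fibre is both open and closed. *)
Lemma locally_constant_connected (T : topologicalType) (U : Type) (f : T -> U) :
  connected [set: T] -> (forall x, \forall y \near x, f y = f x) ->
  forall x y, f x = f y.
Proof.
move=> cT floc x y; have fo (A : set U) : open (f @^-1` A).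
  by rewrite openE => z Az; near=> w; rewrite /preimage /= (near (floc z) w).
suff : f @^-1` [set f y] = setT by move/seteqP => [_ /(_ x I)].
apply: cT; first by exists y.
- by exists (f @^-1` [set f y]); rewrite ?setTI.
- exists (f @^-1` [set f y]); rewrite ?setTI// -openC preimage_setC.
  exact: fo.
Unshelve. all: by end_near. Qed.

(** In a ball around [x] inside [U], the mean value theorem applies to [f] along the segment from
    [x] to [y], where the derivative is 0. *)
Lemma diff0_locally_constant (R : realType) (V : normedModType R)
    (f : V -> R) (U : set V) (x : V) :
  open U -> U x -> (forall y, U y -> differentiable f y) ->
  (forall y v, U y -> 'd f y v = 0) ->
  \forall y \near x, f y = f x.
Proof.
rewrite openE => Uo Ux df df0.
have /nbhs_ballP[e /= e0 xeU] := Uo _ Ux.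
apply/nbhs_ballP; exists e => //= y xey.
pose h (s : R) := x + s *: (y - x).
have hU (s : R) : s \in `[0, 1] -> U (h s).
  rewrite in_itv/= => /andP[s0 s1]; apply: xeU.
  rewrite -ball_normE/= /h opprD addNKr normrN normrZ ger0_norm//.
  apply: (@le_lt_trans _ _ `|y - x|); first by rewrite ler_piMl.
  by move: xey; rewrite -ball_normE /= distrC.
have dh (s : R) : differentiable h s.
  apply: differentiableD; first exact: differentiable_cst.
  exact: differentiableZl.
have dfh (s : R) : s \in `[0, 1] -> is_derive s 1 (f \o h) 0.
  move=> s01; have dfhs : differentiable (f \o h) s.
    by apply: differentiable_comp => //; exact/df/hU.
  apply: DeriveDef; first exact: diff_derivable.
  by rewrite deriveE// diff_comp//=; [rewrite df0//; exact: hU|exact/df/hU].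
have fhc : {within `[0, 1], continuous (f \o h)}.
  by apply: derivable_within_continuous => s /dfh[].
have fhd (s : R) : s \in `]0, 1[%R -> is_derive s 1 (f \o h) 0.
  by move=> /subset_itv_oo_cc; exact: dfh.
have [c _] := @MVT_segment R (f \o h) (fun=> 0) 0 1 ler01 fhd fhc.
rewrite /= /h mul0r scale1r scale0r addr0 [x + _]addrC subrK => /eqP.
by rewrite subr_eq0 => /eqP.
Qed.

(** * Affine maps and the submanifolds they parametrize *)

Section AffineMaps.
Variables (R : realType) (k n : nat).
Implicit Types (C : 'M[R]_(k, n)) (c : 'rV[R]_n).

(** Writing the map as a sum of coordinates times rows of [C] gives the continuity under which a
    linear map is its own differential. *)
Lemma mulmxr_continuous C : continuous (mulmxr C : 'rV[R]_k -> 'rV[R]_n).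
Proof.
move=> u; apply: differentiable_continuous.
have -> : (mulmxr C : 'rV[R]_k -> 'rV[R]_n) =
    \sum_(i < k) (fun u : 'rV[R]_k => u 0 i *: row i C).
  by apply/funext => v; rewrite fct_sumE /= mulmx_sum_row.
by apply: differentiable_sum => i; apply: differentiableZl; exact: differentiable_coord.
Qed.

Lemma is_diff_affine C c u :
  is_diff u (fun u : 'rV[R]_k => c + u *m C) (mulmxr C).
Proof.
have Cc := @mulmxr_continuous C.
have dC : is_diff u (mulmxr C) (mulmxr C).
  by apply: DiffDef; [exact: linear_differentiable|exact: diff_lin].
have : is_diff u (cst c + mulmxr C) (0 + mulmxr C) by exact: is_diffD.
by rewrite add0r.
Qed.

(** Affine maps are closed under directional derivatives: each derivative is constant, that is,
    affine with matrix 0. *)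
Lemma affine_smooth U C c : smooth_on U (fun u : 'rV[R]_k => c + u *m C).
Proof.
move=> vs u _.
suff [C' [c' ->]] : exists C' c', foldr (fun v h => 'D_v h)
    (fun u : 'rV[R]_k => c + u *m C) vs = fun u => c' + u *m C'.
  by have [] := is_diff_affine C' c' u.
elim: vs => [|v vs [C' [c' /= ->]]]; first by exists C, c.
exists 0, (v *m C'); apply/funext => w; rewrite mulmx0 addr0.
have [dw dwE] := is_diff_affine C' c' w.
by rewrite deriveE// dwE.
Qed.

Variables (B : 'M[R]_(k, n)) (freeB : row_free B) (t0 : 'rV[R]_n).

Definition affine_incl (u : 'rV[R]_k) : 'rV[R]_n := t0 + u *m B.

Lemma affine_incl_inj : injective affine_incl.
Proof. by move=> u v /addrI /(row_free_inj freeB). Qed.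

Lemma affine_incl_immersed : immersed_param affine_incl setT id.
Proof.
split=> //.
- exact: openT.
- by move=> u; apply: continuous_subspaceT => v; exact: cvg_id.
- by move=> W _ Wo; rewrite image_id.
- split=> [|u _]; first exact: affine_smooth.
  have [_ dE] := is_diff_affine B t0 u.
  by rewrite [_ \o _](_ : _ = fun u => t0 + u *m B)// dE; exact: row_free_inj.
Qed.

Lemma affine_incl_param (p : 'rV[R]_k) :
  exists (U : set 'rV[R]_k) (psi : 'rV[R]_k -> 'rV[R]_k),
    immersed_param affine_incl U psi /\ (psi @` U) p.
Proof. by exists setT, id; split; [exact: affine_incl_immersed|exists p]. Qed.

Definition affine_submanifold : immersed_submanifold R n :=
  ImmersedSubmanifold (@norm_hausdorff _ 'rV[R]_k) (@rV_second_countable R k)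
    affine_incl_inj affine_incl_param.

End AffineMaps.

(** * The linear functional given by [alpha] *)

Section Dot.
Variables (R : realType) (n : nat) (alpha : 'rV[R]_n).

Lemma dot_mulmx t : dot alpha t = (t *m alpha^T) 0 0.
Proof. by rewrite mxE; apply: eq_bigr => i _; rewrite mxE mulrC. Qed.

Lemma dot_eq0 t : dot alpha t = 0 <-> t *m alpha^T = 0.
Proof.
rewrite dot_mulmx; split=> [t0|->]; last by rewrite mxE.
by apply/rowP => i; rewrite !ord1 t0 mxE.
Qed.

Fact dot_is_linear : linear (dot alpha : 'rV[R]_n -> R).
Proof.
by move=> a u v; rewrite !dot_mulmx mulmxDl -scalemxAl !mxE.
Qed.

HB.instance Definition _ :=
  GRing.isLinear.Build R 'rV[R]_n R *%R (dot alpha) dot_is_linear.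

Lemma dot_delta i : dot alpha (delta_mx 0 i) = alpha 0 i.
Proof.
rewrite /dot (bigD1 i)//= big1 ?addr0 => [|j ji]; rewrite mxE !eqxx ?mulr1//.
by rewrite (negbTE ji) mulr0.
Qed.

Lemma dot_self_neq0 : alpha <> 0 -> dot alpha alpha != 0.
Proof.
move=> a0; apply/eqP => /psumr_eq0P aa0; apply: a0; apply/rowP => i; rewrite mxE.
apply/eqP; rewrite -sqrf_eq0 expr2 aa0// => j _.
by rewrite -expr2 sqr_ge0.
Qed.

Lemma is_diff_dot t : is_diff t (dot alpha) (dot alpha).
Proof.
have ac : continuous (dot alpha).
  move=> u; apply: differentiable_continuous.
  rewrite (_ : dot alpha = \sum_(i < n) (fun t : 'rV[R]_n => t 0 i *: (alpha 0 i : R))).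
    by apply: differentiable_sum => i; apply: differentiableZl; exact: differentiable_coord.
  by apply/funext => v; rewrite fct_sumE; apply: eq_bigr => i _; rewrite [RHS]mulrC.
by apply: DiffDef; [exact: linear_differentiable|exact: diff_lin].
Qed.

Lemma derive_comp_dot (h : R -> R) (dh : R) v t :
  is_derive (dot alpha t) 1 h dh -> 'D_v (h \o dot alpha) t = dh * dot alpha v.
Proof.
move=> [hd hE]; have [da daE] := is_diff_dot t.
have hd' := iffLR (derivable1_diffP _ _) hd.
rewrite deriveE; last exact: differentiable_comp.
by rewrite diff_comp//= daE deriv1E// derive1E hE [LHS]mulrC.
Qed.

End Dot.

(** * Derivatives of the hyperbolic functions *)

Section Hyperbolic.
Variable R : realType.
Implicit Types x : R.

Definition sinh x := (expR x - expR (- x)) / 2.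

Lemma cosh_gt0 x : 0 < cosh x.
Proof. by rewrite divr_gt0// addr_gt0// expR_gt0. Qed.

Lemma is_derive_expRN x : is_derive x 1 (fun x => expR (- x)) (- expR (- x)).
Proof. by rewrite -mulrN1; exact: (@is_derive1_comp _ expR -%R). Qed.

Lemma is_derive_cosh x : is_derive x 1 (@cosh R) (sinh x).
Proof.
have dN := is_derive_expRN x.
rewrite (_ : @cosh R = 2^-1 \*: (expR + (fun x => expR (- x)))).
  by apply: is_derive_eq; rewrite /sinh [RHS]mulrC.
by apply/funext => y; rewrite /cosh mulrC.
Qed.

Lemma is_derive_sinh x : is_derive x 1 sinh (cosh x).
Proof.
have dN := is_derive_expRN x.
rewrite (_ : sinh = 2^-1 \*: (expR - (fun x => expR (- x)))).
  by apply: is_derive_eq; rewrite opprK /cosh [RHS]mulrC.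
by apply/funext => y; rewrite /sinh mulrC.
Qed.

End Hyperbolic.

(** * The Hessian and its radical *)

Section CoshPotential.
Variables (R : realType) (n : nat) (alpha : 'rV[R]_n).

Lemma hessian_cosh_dot t :
  hessian (fun t => cosh (dot alpha t) - 1) t =
  \matrix_(i, j) (cosh (dot alpha t) * alpha 0 i * alpha 0 j).
Proof.
have dcosh (x : R) : is_derive x 1 (fun x : R => cosh x - 1) (sinh x).
  rewrite -[sinh x]addr0.
  exact: (is_deriveD (is_derive_cosh x) (is_derive_cst (-1 : R) x 1)).
have dsinh (a x : R) : is_derive x 1 (fun x : R => a * sinh x) (a * cosh x).
  exact: (is_deriveZ a (is_derive_sinh x)).
apply/matrixP => i j; rewrite !mxE.
(* The inner partial derivative is identified as a function, so that the same chain rule handles the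
   outer one. *)
rewrite (_ : 'D_(delta_mx 0 j) _ = (fun x => alpha 0 j * sinh x) \o dot alpha).
  by rewrite (derive_comp_dot _ (dsinh _ _)) dot_delta; ring.
apply/funext => u; rewrite (derive_comp_dot (h := fun x => cosh x - 1) _ (dcosh _)).
by rewrite dot_delta [LHS]mulrC.
Qed.

Lemma bilin_hessian_cosh_dot t v w :
  bilin (hessian (fun t => cosh (dot alpha t) - 1) t) v w =
  cosh (dot alpha t) * dot alpha v * dot alpha w.
Proof.
rewrite hessian_cosh_dot /bilin /dot -mulrA big_distrlr mulr_sumr /=.
apply: eq_bigr => i _; rewrite mulr_sumr; apply: eq_bigr => j _.
by rewrite mxE; ring.
Qed.

Hypothesis alpha_neq0 : alpha <> 0.

Lemma radical_cosh_dot t :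
  bilin_kernel (hessian (fun t => cosh (dot alpha t) - 1) t) =
  [set v | dot alpha v = 0].
Proof.
apply/seteqP; split=> v /=; last first.
  by move=> v0 w; rewrite bilin_hessian_cosh_dot v0 mulr0 mul0r.
(* Testing against [alpha] itself leaves [dot alpha v] times two nonzero factors, the [cosh] value
   and [dot alpha alpha]. *)
move=> /(_ alpha); rewrite bilin_hessian_cosh_dot => /eqP.
rewrite mulIr_eq0; last exact/mulIf/dot_self_neq0.
by rewrite mulrI_eq0; [move/eqP|apply/mulfI; rewrite gt_eqF// cosh_gt0].
Qed.

(** Rank-nullity for a functional that is onto the one-dimensional space [R^o]. *)
Lemma dot_kernel_dimension : has_dimension [set v | dot alpha v = 0] n.-1.
Proof.
pose f : 'Hom('rV[R]_n, R^o) := linfun (dot alpha : 'rV[R]_n -> R^o).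
exists (lker f); split.
  by apply/seteqP; split=> v /=; rewrite memv_ker lfunE/= => /eqP.
have fimg : limg f = fullv.
  apply/eqP; rewrite eqEsubv subvf /=; apply/subvP => a _.
  have -> : a = f ((a / dot alpha alpha) *: alpha).
    by rewrite lfunE/= linearZ/= divfK// dot_self_neq0.
  by rewrite memv_img// memvf.
have := limg_ker_dim f fullv.
rewrite capfv fimg !dimvf /dim/= mul1n addn1.
by move=> /(congr1 predn).
Qed.

(** * The hyperplanes as integral submanifolds and as leaves *)

Lemma dot_kernelP v :
  dot alpha v = 0 <-> exists w, v = w *m row_base (kermx alpha^T).
Proof.
rewrite dot_eq0; split=> [v0|[w ->]].
  have /submxP[w ->] : (v <= row_base (kermx alpha^T))%MS.
    by rewrite eq_row_base; apply/sub_kermxP.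
  by exists w.
by apply/sub_kermxP/(submx_trans (submxMl _ _)); rewrite eq_row_base.
Qed.

(** The base point is the foot of the perpendicular from the origin. [row_base] supplies free rows,
    so the parameter space has dimension [\rank (kermx alpha^T)]. *)
Definition hyperplane_submanifold (c : R) : immersed_submanifold R n :=
  affine_submanifold (row_base_free (kermx alpha^T))
    ((c / dot alpha alpha) *: alpha).

Lemma dot_hyperplane_incl c (p : sm_space (hyperplane_submanifold c)) :
  dot alpha (sm_incl p) = c.
Proof.
have B0 : dot alpha (p *m row_base (kermx alpha^T)) = 0.
  by apply/dot_kernelP; exists p.
rewrite /= /affine_incl linearD/= B0 addr0 linearZ/= divfK//.
exact: dot_self_neq0.
Qed.

Lemma hyperplane_submanifold_points c :
  sm_points (hyperplane_submanifold c) = [set t | dot alpha t = c].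
Proof.
apply/seteqP; split=> [_ [p _ <-]|t /= tc]; first exact: dot_hyperplane_incl.
have /dot_kernelP[w tE] : dot alpha (t - (c / dot alpha alpha) *: alpha) = 0.
  by rewrite linearB/= linearZ/= divfK ?dot_self_neq0// tc subrr.
by exists w => //=; rewrite /affine_incl -tE addrC subrK.
Qed.

Lemma hyperplane_submanifold_integral c :
  integral_submanifold (fun=> [set v | dot alpha v = 0])
    (hyperplane_submanifold c).
Proof.
move=> p; apply/seteqP; split=> [v [U [psi [u [w [psiP Uu _ ->]]]]]|v /=].
  set i := @sm_incl _ _ (hyperplane_submanifold c) \o psi.
  have [_ _ _ _ [/(_ [::] u Uu)/= di _]] := psiP.
  have [da daE] := is_diff_dot alpha (i u).
  have : 'd (dot alpha \o i) u w = 0.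
    (* Whatever the parametrization [psi], the inclusion lands in the hyperplane, so the composite
       is constant and its differential vanishes. *)
    rewrite (_ : _ \o _ = cst c); first by rewrite diff_cst.
    by apply/funext => q; exact: dot_hyperplane_incl.
  by rewrite diff_comp//= daE.
move=> /dot_kernelP[w ->].
(* In the global parametrization the differential is multiplication by the basis matrix, which
   reaches every vector of the kernel. *)
exists setT, id, p, w; split=> //; first exact: (affine_incl_immersed (row_base_free _)).
have [_ dE] := is_diff_affine (row_base (kermx alpha^T))
  ((c / dot alpha alpha) *: alpha) p.
exact: (esym (congr1 (@^~ w) dE)).
Qed.

Lemma hyperplane_submanifold_connected c :
  connected [set: sm_space (hyperplane_submanifold c)].
Proof. exact: normedModType_connected. Qed.

Lemma connected_integral_dot_cst (M : immersed_submanifold R n) :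
  connected_integral (fun=> [set v | dot alpha v = 0]) M ->
  forall p q : sm_space M, dot alpha (sm_incl p) = dot alpha (sm_incl q).
Proof.
move=> [Mint Mco]; apply: locally_constant_connected => // p.
have [U [psi [psiP [u Uu up]]]] := sm_param p.
have [Uo _ _ psio [dpsi _]] := psiP.
set i := @sm_incl _ _ M \o psi in dpsi.
have di y : U y -> differentiable i y by exact: (dpsi [::]).
have : \forall y \near u, dot alpha (i y) = dot alpha (i u).
  apply: (@diff0_locally_constant _ _ (dot alpha \o i) U) => // y.
    by move=> Uy; apply: differentiable_comp; [exact: di|have [] := is_diff_dot alpha (i y)].
  move=> v Uy; have [da daE] := is_diff_dot alpha (i y).
  rewrite diff_comp//=; last exact: di.
  (* Integrality puts the image of the differential in the kernel of [dot alpha]. *)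
  rewrite daE; have : tangent_space (psi y) ('d i y v) by exists U, psi, y, v.
  by rewrite Mint.
move=> iu; have Unbhs : nbhs u U by exact: open_nbhs_nbhs.
(* Taking the interior gives an open subset of [U], whose image under [psi] is open; constancy near
   [u] thus becomes constancy near [p]. *)
pose W := (U `&` [set y | dot alpha (i y) = dot alpha (i u)])°.
have Wo : open (psi @` W).
  by apply: psio; [move=> y /interior_subset[]|exact: open_interior].
have : nbhs p (psi @` W).
  by apply: open_nbhs_nbhs; split=> //; exists u => //; exact: filterI.
by apply: filterS => _ [y /interior_subset[_ yE] <-]; rewrite -up.
Qed.

Lemma leaf_dot_kernel (L : set 'rV[R]_n) :
  leaf (fun=> [set v | dot alpha v = 0]) L <->
  exists c : R, L = [set t | dot alpha t = c].
Proof.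
have hyp c : connected_integral (fun=> [set v | dot alpha v = 0])
    (hyperplane_submanifold c).
  by split; [exact: hyperplane_submanifold_integral|
             exact: hyperplane_submanifold_connected].
split=> [[[t Lt]] [M [Mint ML Mmax]]|[c ->]].
  exists (dot alpha t); rewrite -hyperplane_submanifold_points.
  (* Maximality of the leaf is applied to the hyperplane through one of its points, which contains
     the whole leaf. *)
  apply/esym/Mmax => //; rewrite hyperplane_submanifold_points.
  move: Lt; rewrite -ML => -[p _ <-] _ [q _ <-] /=.
  exact: connected_integral_dot_cst.
split.
  exists ((c / dot alpha alpha) *: alpha).
  by rewrite /= linearZ/= divfK// dot_self_neq0.
exists (hyperplane_submanifold c); split=> //.
  exact: hyperplane_submanifold_points.
move=> M Mint LM; apply/seteqP; split=> // _ [p _ <-] /=.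
(* A single point of the hyperplane lying in [M] fixes the constant value of [dot alpha] on [M] as
   [c]. *)
have [q _ qE] : sm_points M ((c / dot alpha alpha) *: alpha).
  by apply: LM; rewrite /= linearZ/= divfK// dot_self_neq0.
rewrite (connected_integral_dot_cst Mint p q) qE linearZ/= divfK//.
exact: dot_self_neq0.
Qed.

End CoshPotential.

Unset Implicit Arguments.

Theorem mainTheorem2 (R : realType) (n : nat) (n_ge1 : (1 <= n)%N)
    (alpha : 'rV[R]_n) (alpha_neq0 : alpha <> 0) :
  let J := fun t : 'rV[R]_n => cosh (dot alpha t) - 1 in
  let g := hessian J in
  let Ralpha := [set v : 'rV[R]_n | dot alpha v = 0] in
  let radical := fun t : 'rV[R]_n => bilin_kernel (g t) in
  [/\ forall t : 'rV[R]_n, (g t)^T = g t /\ radical t = Ralpha,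
      has_dimension Ralpha n.-1,
      integrable_distribution radical
    & forall L : set 'rV[R]_n,
        leaf radical L <->
        exists c : R, L = [set t : 'rV[R]_n | dot alpha t = c]].
Proof.
move=> J g Ralpha radical.
(* The radical is a constant distribution, which reduces integrability and the leaves to the results
   on [dot alpha]. *)
have radicalE : radical = fun=> Ralpha.
  by apply/funext => t; exact: radical_cosh_dot.
split.
- move=> t; rewrite radicalE; split=> //; rewrite /g hessian_cosh_dot.
  by apply/matrixP => i j; rewrite !mxE mulrAC.
- exact: dot_kernel_dimension.
- rewrite radicalE => t; exists (hyperplane_submanifold alpha (dot alpha t)); split.
    exact: hyperplane_submanifold_integral.
  by rewrite hyperplane_submanifold_points.
- by move=> L; rewrite radicalE; exact: leaf_dot_kernel.
Qed.
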